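(* Let $G$ be an infinite (finitely generated) polycyclic group. Then $G$ is periodically rigid if and only if $G$ is either virtually $\mathbb Z$, or torsion-free and virtually $\mathbb Z^2$.
   Context: A group $G$ is polycyclic if it admits a series $\{1_G\}=G_0\trianglelefteq G_1\trianglelefteq\dots\trianglelefteq G_n=G$ with every quotient $G_{i+1}/G_i$ cyclic (finite or infinite). A group is virtually $\mathbb Z^d$ if it has a finite index subgroup isomorphic to $\mathbb Z^d$. Let $A$ be a non-empty finite set. $G$ acts on $A^G$ by $(g\cdot x)(h)=x(g^{-1}h)$. A pattern is a map $p:F\to A$ with $F\subset G$ finite; it appears in $x\in A^G$ if there is $g\in G$ with $p(h)=x(gh)$ for all $h\in F$. A subset $X\subseteq A^G$ is a subshift of finite type ($G$-SFT) if it consists of exactly those configurations in which no pattern of some finite set of patterns appears. A $G$-SFT $X$ is weakly aperiodic if it is non-empty and every $x\in X$ has infinite orbit $\{g\cdot x:g\in G\}$; it is strongly aperiodic if it is non-empty and $\mathrm{stab}(x)=\{g\in G:g\cdot x=x\}$ is trivial for every $x\in X$. A group $G$ is periodically rigid if every weakly aperiodic $G$-SFT (over any finite alphabet) is strongly aperiodic. *)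

(* Defs.v *)
From HB Require Import structures.
From mathcomp Require Import all_boot all_order all_algebra finmap.
From mathcomp Require Import all_classical.

Set Implicit Arguments.
Unset Strict Implicit.
Unset Printing Implicit Defensive.

Local Open Scope classical_set_scope.
Local Open Scope group_scope.

Section GroupTheory.
Variable G : groupType.
Implicit Types (g t : G) (H K : set G).

Definition is_subgroup H : Prop := group_closed (mem H).

Definition lcoset g H : set G := [set g * h | h in H].

Definition is_normal_in H K : Prop :=
  H `<=` K /\ forall k h, K k -> H h -> H (h ^ k).

Definition zpow g (k : int) : G :=
  match k with Posz n => g ^+ n | Negz n => g ^- n.+1 end.

(* For H normal in K the k-th power of the coset [t H] in [K / H] is [t^k H]:
   the quotient is generated by the class of a single [t]. *)
Definition cyclic_quotient K H : Prop :=
  exists2 t, K t &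
    forall g, K g -> exists k : int, lcoset g H = lcoset (zpow t k) H.

Definition polycyclic : Prop :=
  exists (n : nat) (S : nat -> set G),
    [/\ forall i, (i <= n)%N -> is_subgroup (S i),
        S 0 = [set 1],
        S n = [set: G] &
        forall i, (i < n)%N ->
          is_normal_in (S i) (S i.+1) /\ cyclic_quotient (S i.+1) (S i)].

Definition finitely_generated : Prop :=
  exists2 S : set G, finite_set S &
    forall H, is_subgroup H -> S `<=` H -> H = [set: G].

Definition finite_index H : Prop :=
  finite_set [set lcoset g H | g in [set: G]].

Definition isomorphic_to_Zd (d : nat) H : Prop :=
  exists2 f : 'rV[int]_d -> G,
    {morph f : u v / (u + v)%R >-> u * v} & set_bij [set: 'rV[int]_d] H f.

Definition virtually_Zd (d : nat) : Prop :=
  exists H, [/\ is_subgroup H, finite_index H & isomorphic_to_Zd d H].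

Definition torsion_free : Prop :=
  forall g (n : nat), (0 < n)%N -> g ^+ n = 1 -> g = 1.

End GroupTheory.

Section Subshifts.
Variables (G : groupType) (A : finType).
Implicit Types (x : G -> A) (X : set (G -> A)).

Definition shift (g : G) x : G -> A := fun h => x (g^-1 * h).

Definition orbit x : set (G -> A) := [set shift g x | g in [set: G]].

Definition stab x : set G := [set g | shift g x = x].

(* A pattern is a map from a finite subset [domf p] of [G] to [A]. *)
Definition appears (p : {fmap G -> A}) x : Prop :=
  exists g : G, forall h : domf p, p h = x (g * val h).

Definition is_SFT X : Prop :=
  exists P : {fset {fmap G -> A}},
    X = [set x | forall p, p \in P -> ~ appears p x].

Definition weakly_aperiodic X : Prop :=
  X !=set0 /\ forall x, X x -> infinite_set (orbit x).

Definition strongly_aperiodic X : Prop :=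
  X !=set0 /\ forall x, X x -> stab x = [set 1].

End Subshifts.

Definition periodically_rigid (G : groupType) : Prop :=
  forall (A : finType), (0 < #|A|)%N ->
  forall X : set (G -> A),
    is_SFT X -> weakly_aperiodic X -> strongly_aperiodic X.

(* Main.v *)
From mathcomp Require Import all_boot all_order all_algebra finmap.
From mathcomp Require Import all_classical.
From mathcomp Require Import zify lra.
Require Import Defs.

(** Rigidity comes from a pigeonhole argument.  If [t] and [v] commute, [t] has
    infinite order modulo [<v>], the subgroup [<t, v>] has finite index, and a
    configuration [x] of an SFT is fixed by [v], then [x] amounts to a
    bi-infinite word over a finite alphabet, read along the powers of [t]; by
    pigeonhole the word can be made periodic without creating a new window,
    which yields a configuration with a finite orbit
    ([SFT_finite_orbit_point]).  With [v = 1] this shows that a virtually [Z]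
    group has no weakly aperiodic SFT at all.  In a torsion-free virtually
    [Z^2] group any [g <> 1] fixing [x] has a power which is a non-zero vector
    of [Z^2]; this power serves as [v], and again weak aperiodicity fails.  So
    both kinds of groups are rigid.

    Conversely, Kari's construction gives Wang tiles that tile [Z^2] but never
    with two independent periods ([kari_tiling], [kari_no_double_period]).
    Their rule can be imposed on the cosets of any copy of [Z^2] in [G]; the
    resulting SFT has no finite orbit, and its restrictions to distinct cosets
    are independent of each other.  If some [k <> 1] has no non-trivial power
    conjugate into that [Z^2], then [<k>] permutes the cosets freely, and one
    tiling can be copied along [<k>] to give a configuration fixed by [k]:
    the SFT is weakly but not strongly aperiodic
    ([free_extension_not_rigid]).  A torsion element [k] always qualifies,
    which settles virtually [Z^2] groups with torsion.  The construction also
    applies to every group in which a finite-index subgroup [K] has a non-zero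
    homomorphism [phi : K -> Z] whose kernel contains [Z^2]
    ([fibred_not_rigid]): one takes [k] outside the kernels of the finitely
    many conjugates of [phi].

    It remains to see that a polycyclic group is finite, virtually [Z],
    virtually [Z^2] or of the last kind ([polycyclic_small_or_fibred]).  This
    goes up the series: a finite cyclic quotient does not change the kind, and
    an infinite one turns finite into virtually [Z], virtually [Z] into
    virtually [Z^2], and anything containing [Z^2] into the last kind. *)

Set Implicit Arguments.
Unset Strict Implicit.
Unset Printing Implicit Defensive.

Import Order.TTheory GRing.Theory Num.Theory.
Local Open Scope classical_set_scope.
Local Open Scope group_scope.

(** * An aperiodic set of Wang tiles *)

(** Kari's tiles.  Along each row runs a transducer multiplying by 2 or by 2/3
    the number whose digits are written in that row; a tile records which of
    the two, the digit it reads, and the carry entering from the left.  The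
    digit written is the one read by the tile above, and the carry leaving is
    the one entering the next tile.  The carries are multiples of 1/3 lying
    between -5/3 and 2/3: they are stored multiplied by 3 and shifted by 5. *)
Definition tile : finType := (bool * 'I_3 * 'I_8)%type.

Definition doubling (c : tile) : bool := c.1.1.
Definition digit (c : tile) : nat := c.1.2.
Definition carry (c : tile) : nat := c.2.

(** Three times the multiplier of the row. *)
Definition factor (c : tile) : nat := if doubling c then 6 else 2.

(** [c] is a tile, [r] its right neighbour and [t] the one above it.  The
    middle condition excludes the null tiling: a row multiplied by 2/3 has only
    positive digits, and one of any two consecutive rows is of this kind. *)
Definition kari_rule (c r t : tile) : bool :=
  [&& doubling r == doubling c,
      if doubling c then ~~ doubling t else (0 < digit c)%N &
      (factor c * digit c + carry c == 3 * digit t + carry r)%N].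

Lemma PoszS n : Posz n.+1 = (Posz n + 1)%R.
Proof. by rewrite -PoszD addn1. Qed.

(** On a torus the carries of a row cancel, so that the sum of the digits is
    multiplied by exactly 2 or 2/3 from each row to the next.  After a vertical
    period it is back to its value, which is positive, whereas a non-empty
    product of factors 2 and 2/3 is never 1. *)
Section NoPeriod.
Variable w : int -> int -> tile.
Hypothesis w_rule : forall i j, kari_rule (w i j) (w (i + 1) j)%R (w i (j + 1))%R.
Variables m p : nat.
Hypotheses (m_gt0 : (0 < m)%N) (p_gt0 : (0 < p)%N).
Hypothesis w_horiz : forall i j, w (i + m%:Z)%R j = w i j.
Hypothesis w_vert : forall i j, w i (j + p%:Z)%R = w i j.

Let row (j : int) : nat := \sum_(i < m) digit (w i%:Z j).

Let doubling_row j i : doubling (w (Posz i) j) = doubling (w 0%R j).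
Proof.
elim: i => // i <-; have /and3P[/eqP<- _ _] := w_rule i j.
by rewrite -PoszS.
Qed.

Let row_step j : (3 * row (j + 1)%R = factor (w 0%R j) * row j)%N.
Proof.
have carries : (\sum_(i < m) carry (w (i%:Z + 1)%R j) =
    \sum_(i < m) carry (w i%:Z j))%N.
  case: m m_gt0 w_horiz => // m' _ wh.
  rewrite big_ord_recr [RHS]big_ord_recl [RHS]addnC; congr addn.
    by apply: eq_bigr => i _; rewrite lift0 -PoszS.
  by rewrite -PoszS -[Posz m'.+1]add0r wh.
apply/eqP; rewrite -(eqn_add2r (\sum_(i < m) carry (w i%:Z j))) -{1}carries.
rewrite !big_distrr -!big_split; apply/eqP/eq_bigr => i _ /=.
have /and3P[_ _ /eqP<-] := w_rule i j.
by rewrite /factor doubling_row.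
Qed.

Let row_gt0 j : (0 < row j)%N.
Proof.
have half j' : ~~ doubling (w 0%R j') -> (0 < row j')%N.
  move=> nd; rewrite /row; case: m m_gt0 => // m' _.
  rewrite big_ord_recl ltn_addr //=.
  by have /and3P[_ + _] := w_rule 0%R j'; rewrite (negPf nd).
case d: (doubling (w 0%R j)); last by apply: half; rewrite d.
have : (0 < row (j + 1)%R)%N.
  by apply: half; have /and3P[_ + _] := w_rule 0%R j; rewrite d.
by have := row_step j; rewrite /factor d -(ltn_pmul2l (isT : 0 < 3)%N) => ->; lia.
Qed.

Lemma kari_no_double_period : False.
Proof.
have [a] : exists a, (3 ^ p * row p = 2 ^ p * 3 ^ a * row 0%R)%N.
  elim: p => [|n [a IH]]; first by exists 0.
  have := row_step n; rewrite -PoszS /factor => stp.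
  case: (doubling _) stp => stp; [exists a.+1|exists a];
    rewrite ?expnS -mulnA mulnCA stp; nia.
have -> : row p = row 0%R.
  by apply: eq_bigr => i _; rewrite -[Posz p]add0r w_vert.
move=> /eqP; rewrite eqn_pmul2r ?row_gt0 // => /eqP /(congr1 odd).
rewrite oddM !oddX /=; by case: p p_gt0.
Qed.

End NoPeriod.

(** The tilings.  The map [speed] is a bijection of the interval [2/3, 2), so
    that 1 has a two-sided orbit [slope] in it, and row [j] is filled with the
    digits [floor ((i + 1) a) - floor (i a)] of average [a = slope j]. *)
Section Beatty.
Local Open Scope ring_scope.

Definition speed (x : rat) : rat := if x < 1 then 2 * x else 2 / 3 * x.
Definition speed_inv (x : rat) : rat := if x < 4 / 3 then 3 / 2 * x else x / 2.

Definition slope (j : int) : rat :=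
  match j with
  | Posz n => iter n speed 1
  | Negz n => iter n.+1 speed_inv 1
  end.

Let in_dom (x : rat) := (2 / 3 <= x < 2).

Let speed_dom x : in_dom x -> in_dom (speed x).
Proof.
by rewrite /in_dom /speed => /andP[? ?]; case: ltP => ?; apply/andP; split; lra.
Qed.

Let speed_inv_dom x : in_dom x -> in_dom (speed_inv x).
Proof.
rewrite /in_dom /speed_inv => /andP[? ?].
by case: ltP => ?; apply/andP; split; lra.
Qed.

Let speed_invK x : in_dom x -> speed (speed_inv x) = x.
Proof.
rewrite /in_dom /speed /speed_inv => /andP[? ?].
by case: (ltP x) => ?; case: ltP => ?; lra.
Qed.

Lemma slope_dom j : in_dom (slope j).
Proof.
have start : in_dom 1 by rewrite /in_dom; lra.
have iterP f : (forall x, in_dom x -> in_dom (f x)) ->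
    forall n, in_dom (iter n f 1) by move=> fP; elim=> //= n /fP.
by case: j => n; apply: iterP.
Qed.

Lemma slopeS j : slope (j + 1) = speed (slope j).
Proof.
case: j => [n|[|n]]; first by rewrite -PoszS.
  by rewrite /= speed_invK //; exact: (slope_dom 0).
have -> : Negz n.+1 + 1 = Negz n by lia.
by rewrite [RHS]/= speed_invK //; exact: (slope_dom (Negz n)).
Qed.

Definition beatty (i j : int) : int := Num.floor (i%:~R * slope j).

Let beatty_bounds i j :
  (beatty i j)%:~R <= i%:~R * slope j < (beatty i j)%:~R + 1.
Proof. by have := floor_itv (i%:~R * slope j); rewrite intrD. Qed.

Let lt_int (a b : int) : ((a%:~R : rat) < b%:~R) -> a < b.
Proof. by rewrite ltr_int. Qed.

Definition beatty_tile (i j : int) : tile :=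
  let d := slope j < 1 in
  (d, inord (absz (beatty (i + 1) j - beatty i j)),
   inord (absz ((if d then 6 else 2) * beatty i j - 3 * beatty i (j + 1) + 5))).

Lemma digit_beatty i j :
  (digit (beatty_tile i j))%:Z = beatty (i + 1) j - beatty i j
  /\ (~~ (slope j < 1) -> 1 <= beatty (i + 1) j - beatty i j).
Proof.
have /andP[l1 u1] := beatty_bounds i j.
have /andP[] := beatty_bounds (i + 1) j.
rewrite intrD mulrDl mul1r => l2 u2.
have /andP[ls us] := slope_dom j.
have lo : -1 < beatty (i + 1) j - beatty i j.
  by apply: lt_int; rewrite intrB; lra.
have hi : beatty (i + 1) j - beatty i j < 3.
  by apply: lt_int; rewrite intrB; lra.
split; last first.
  rewrite -leNgt => s1; have : 0 < beatty (i + 1) j - beatty i j; last by lia.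
  by apply: lt_int; rewrite intrB; lra.
rewrite /digit /=; rewrite inordK; lia.
Qed.

(** The carry is bounded since [q floor (i a) - floor (i q a)] is a difference
    of fractional parts, that of [i q a] minus [q] times that of [i a]. *)
Lemma carry_beatty i j : (carry (beatty_tile i j))%:Z =
  (if slope j < 1 then 6 else 2) * beatty i j - 3 * beatty i (j + 1) + 5.
Proof.
have /andP[l1 u1] := beatty_bounds i j.
have /andP[] := beatty_bounds i (j + 1).
rewrite slopeS /speed /carry /=; case: ltP => s1 l2 u2.
  have lo : 2 * beatty i j - beatty i (j + 1) < 1.
    by apply: lt_int; rewrite intrB intrM; lra.
  have hi : - 2 < 2 * beatty i j - beatty i (j + 1).
    by apply: lt_int; rewrite intrB intrM; lra.
  by rewrite inordK; lia.
have lo : 2 * beatty i j - 3 * beatty i (j + 1) < 3.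
  by apply: lt_int; rewrite intrB !intrM; lra.
have hi : - 2 < 2 * beatty i j - 3 * beatty i (j + 1).
  by apply: lt_int; rewrite intrB !intrM; lra.
by rewrite inordK; lia.
Qed.

Lemma kari_tiling : exists w : int -> int -> tile,
  forall i j, kari_rule (w i j) (w (i + 1) j) (w i (j + 1)).
Proof.
exists beatty_tile => i j; rewrite /kari_rule /factor.
have [d0 pos] := digit_beatty i j; have [d1 _] := digit_beatty i (j + 1).
have c0 := carry_beatty i j; have c1 := carry_beatty (i + 1) j.
have dE j' i' : doubling (beatty_tile i' j') = (slope j' < 1) by [].
rewrite !dE eqxx andTb; have /andP[sl su] := slope_dom j.
case: ltP c0 c1 pos => s1 c0 c1 pos; apply/andP; split; try by lia.
by rewrite -leNgt slopeS /speed s1; lra.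
Qed.

End Beatty.

(** * Integer powers and commuting pairs *)

Section IntegerPowers.
Variable G : groupType.
Implicit Types (g h u v : G) (i j : int) (K : set G).

Lemma zpow0 g : zpow g 0 = 1. Proof. by []. Qed.

Lemma zpow1 g : zpow g 1 = g. Proof. exact: expg1. Qed.

Lemma zpowS g i : zpow g (i + 1)%R = zpow g i * g.
Proof.
case: i => [n|[|n]]; first by rewrite -PoszS /= expgSr.
  by rewrite /= expg1 mulVg.
have -> : (Negz n.+1 + 1)%R = Negz n by lia.
by rewrite /= [in RHS]expgS invgM mulgVK.
Qed.

Lemma zpowD g i j : zpow g (i + j)%R = zpow g i * zpow g j.
Proof.
elim/int_ind: j => [|n IH|n IH]; first by rewrite addr0 mulg1.
  by rewrite PoszS addrA !zpowS IH mulgA.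
have e : (- n.+1%:Z + 1)%R = (- n%:Z)%R by lia.
by apply: (mulIg g); rewrite -mulgA -!zpowS -addrA e.
Qed.

Lemma zpowN g i : zpow g (- i)%R = (zpow g i)^-1.
Proof. by apply: (mulIg (zpow g i)); rewrite mulVg -zpowD addNr. Qed.

Lemma zpowM g i j : zpow g (i * j)%R = zpow (zpow g i) j.
Proof.
have nat_mul n : zpow g (i * n%:Z)%R = zpow (zpow g i) n.
  elim: n => [|n IH]; first by rewrite mulr0.
  by rewrite PoszS mulrDr mulr1 zpowS -IH -zpowD.
by case: j => n; rewrite // NegzE mulrN !zpowN nat_mul.
Qed.

Lemma zpow1g i : zpow 1 i = 1 :> G.
Proof. by case: i => n; rewrite /= expg1n ?invg1. Qed.

Lemma zpowJ g h i : zpow g i ^ h = zpow (g ^ h) i.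
Proof. by case: i => n; rewrite /= ?conjVg conjXg. Qed.

Lemma commute_zpow g h i : commute g h -> commute g (zpow h i).
Proof.
by case: i => n c; [|apply: commuteV]; apply: commuteX.
Qed.

Section Subgroups.
Variable K : set G.
Hypothesis gK : is_subgroup K.

Lemma subgroup1 : K 1. Proof. by have := gK.1; rewrite in_setE. Qed.

Lemma subgroupM g h : K g -> K h -> K (g * h).
Proof. by rewrite -!(in_setE K); exact: (group_closedM gK). Qed.

Lemma subgroupV g : K g -> K g^-1.
Proof. by rewrite -!(in_setE K); exact: (group_closedV gK). Qed.

Lemma subgroup_zpow g i : K g -> K (zpow g i).
Proof.
have pos n : K g -> K (g ^+ n).
  by move=> Kg; elim: n => [|n IH]; [exact: subgroup1|rewrite expgS; exact: subgroupM].
by move=> Kg; case: i => n; [|apply: subgroupV]; apply: pos.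
Qed.
End Subgroups.

Lemma is_subgroupP K :
  K 1 -> (forall g h, K g -> K h -> K (g / h)) -> is_subgroup K.
Proof.
by move=> K1 KV; split=> [|g h]; rewrite !in_setE //; exact: KV.
Qed.

(** This is the subgroup generated by [u] and [v] when they commute. *)
Definition gen2 u v : set G := [set g | exists i j, g = zpow u i * zpow v j].

Definition free_pair u v : Prop :=
  forall i j, zpow u i * zpow v j = 1 -> i = 0%R /\ j = 0%R.

Section CommutingPair.
Variables u v : G.
Hypothesis cuv : commute u v.

Lemma gen2M i j i' j' :
  (zpow u i * zpow v j) * (zpow u i' * zpow v j') =
  zpow u (i + i')%R * zpow v (j + j')%R.
Proof.
have c : commute (zpow v j) (zpow u i').
  by apply/commute_zpow/commute_sym/commute_zpow.
by rewrite !zpowD -!mulgA; congr (_ * _); rewrite !mulgA c.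
Qed.

Lemma gen2V i j :
  (zpow u i * zpow v j)^-1 = zpow u (- i)%R * zpow v (- j)%R.
Proof.
by apply: (mulgI (zpow u i * zpow v j)); rewrite mulgV gen2M !subrr mulg1.
Qed.

Lemma gen2X i j n :
  zpow (zpow u i * zpow v j) n = zpow u (i * n)%R * zpow v (j * n)%R.
Proof.
have nat_mul m : zpow (zpow u i * zpow v j) m%:Z =
    zpow u (i * m%:Z)%R * zpow v (j * m%:Z)%R.
  elim: m => [|m IH]; first by rewrite !mulr0 mulg1.
  by rewrite PoszS zpowS IH gen2M !mulrDr !mulr1.
by case: n => n; rewrite // NegzE zpowN nat_mul gen2V !mulrN.
Qed.

Lemma gen2_subgroup : is_subgroup (gen2 u v).
Proof.
apply: is_subgroupP => [|_ _ [i [j ->]] [i' [j' ->]]].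
  by exists 0%R, 0%R; rewrite mulg1.
by rewrite gen2V gen2M; do 2!eexists.
Qed.

Lemma free_pair_inj i j i' j' : free_pair u v ->
  zpow u i * zpow v j = zpow u i' * zpow v j' -> i = i' /\ j = j'.
Proof.
move=> fr /(congr1 (fun g => g * (zpow u i' * zpow v j')^-1)).
rewrite mulgV gen2V gen2M => /fr[/eqP + /eqP].
by rewrite !subr_eq0 => /eqP-> /eqP->.
Qed.

End CommutingPair.
End IntegerPowers.

(** * Subshifts given by a local rule *)

Lemma pigeonhole_seq (T : eqType) (s : seq T) (f : nat -> T) :
  (forall n, f n \in s) -> exists a b, [/\ (a < b)%N, (b <= size s)%N & f a = f b].
Proof.
move=> fs; have : ~~ uniq (mkseq f (size s).+1).
  apply/negP => /uniq_leq_size H.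
  have : (size (mkseq f (size s).+1) <= size s)%N.
    by apply: H => _ /mapP[n _ ->]; exact: fs.
  by rewrite size_mkseq ltnn.
move=> /(uniqPn (f 0)) [a [b [ab]]]; rewrite size_mkseq => bs.
rewrite !nth_mkseq // ?(ltn_trans ab) // => fab.
by exists a, b.
Qed.

Section LocalRules.
Variables (G : groupType) (A : finType).
Implicit Types (g u v k : G) (x : G -> A).

(** Finiteness of the alphabet enters here: there are finitely many patterns on
    the window [F], and the forbidden ones are those violating [Q]. *)
Lemma window_rule_SFT (F : {fset G}) (Q : pred {ffun F -> A}) :
  is_SFT [set x : G -> A | forall g, Q [ffun h => x (g * val h)]].
Proof.
exists (seq_fset tt [seq ([fmap h : F => f h] : {fmap G -> A}) |
  f : {ffun F -> A} <- enum {: {ffun F -> A}} & ~~ Q f]).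
apply/seteqP; split=> x xP.
  move=> p; rewrite seq_fsetE => /mapP[f]; rewrite mem_filter => /andP[nQ _] ->{p} [g gP].
  move/negP: nQ; apply; suff -> : f = [ffun h => x (g * val h)] by [].
  by apply/ffunP => h; rewrite ffunE -gP ffunE.
move=> g; apply/negPn/negP => nQ.
apply: (xP [fmap h : F => [ffun h => x (g * val h)] h]); last first.
  by exists g => h; rewrite !ffunE.
by rewrite seq_fsetE; apply: map_f; rewrite mem_filter nQ mem_enum.
Qed.

Lemma neighbour_rule_SFT u v (R : A -> A -> A -> bool) :
  is_SFT [set x : G -> A | forall g, R (x g) (x (g * u)) (x (g * v))].
Proof.
set F : {fset G} := [fset 1; u; v]%fset.
have F1 : 1 \in F by rewrite !inE eqxx.
have Fu : u \in F by rewrite !inE eqxx orbT.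
have Fv : v \in F by rewrite !inE eqxx !orbT.
have := @window_rule_SFT F (fun f => R (f [` F1]) (f [` Fu]) (f [` Fv]))%fset.
congr is_SFT; apply/seteqP; split=> x /= xP g; have := xP g.
  by rewrite !ffunE /= mulg1.
by rewrite !ffunE /= mulg1.
Qed.

Lemma shiftM g h x : shift (g * h) x = shift g (shift h x).
Proof. by apply/funext => a; rewrite /shift invgM mulgA. Qed.

Lemma shift1 x : shift 1 x = x.
Proof. by apply/funext => a; rewrite /shift invg1 mul1g. Qed.

Lemma shift_zpow g x n : shift g x = x -> shift (zpow g n) x = x.
Proof.
move=> gx; have nat_pow m : shift (g ^+ m) x = x.
  by elim: m => [|m IH]; rewrite ?shift1 // expgS shiftM IH.
case: n => n /=; first exact: nat_pow.
by rewrite -{1}(nat_pow n.+1) -shiftM mulVg shift1.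
Qed.

Lemma finite_orbit_period g x : finite_set (orbit x) ->
  exists2 m : nat, (0 < m)%N & forall h, x (zpow g m * h) = x h.
Proof.
move=> /finite_seqP[s orb_s].
have in_s n : shift (g ^+ n) x \in s.
  suff : orbit x (shift (g ^+ n) x) by rewrite orb_s.
  by exists (g ^+ n).
have [a [b [ab _ xab]]] := pigeonhole_seq in_s.
exists (b - a)%N; rewrite ?subn_gt0 // => h.
have := congr1 (fun y : G -> A => y (g ^+ b * h)) xab.
rewrite /shift mulKg => <-; congr x.
by rewrite mulgA; congr (_ * _); rewrite -{2}(subnKC (ltnW ab)) expgnDr mulKg.
Qed.

End LocalRules.

(** * A weakly aperiodic subshift with a symmetric configuration *)

(** [G] is cut into the double cosets of [<k>] and [<u, v>].  By [k_conj], the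
    element [k^n r u^i v^j] of the double coset of [r] determines [i] and [j],
    so a configuration on [Z^2] can be copied on each double coset, and the
    result is invariant under [k]. *)
Section FreeExtension.
Variable G : groupType.
Variables u v k : G.
Hypothesis cuv : commute u v.
Hypothesis k_conj : forall g n i j,
  zpow k n ^ g = zpow u i * zpow v j -> i = 0%R /\ j = 0%R.

Let cls g : set G :=
  [set g' | exists n i j, g' = zpow k n * g * (zpow u i * zpow v j)].

Let cls_eq n g i j : cls (zpow k n * g * (zpow u i * zpow v j)) = cls g.
Proof.
apply/seteqP; split=> g' [m [a [b ->]]].
  exists (m + n)%R, (i + a)%R, (j + b)%R.
  by rewrite zpowD -(gen2M cuv) !mulgA.
exists (m - n)%R, (a - i)%R, (b - j)%R.
have {1}-> : m = (m - n + n)%R by lia.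
have {1}-> : a = (i + (a - i))%R by lia.
have {1}-> : b = (j + (b - j))%R by lia.
by rewrite (zpowD k) -(gen2M cuv) !mulgA.
Qed.

Let rep g := xget 1 (cls g).

Let coord_ex g : exists c : int * int, exists n,
  g = zpow k n * rep g * (zpow u c.1 * zpow v c.2).
Proof.
have : cls g (rep g).
  by apply: (@xgetI _ _ _ g); exists 0%R, 0%R, 0%R; rewrite mul1g !mulg1.
case=> n [i [j E]]; exists (- i, - j)%R, (- n)%R.
by rewrite /= E zpowN -(gen2V cuv) -[zpow k n * g * _]mulgA mulKg mulgK.
Qed.

Lemma coordinates : exists c : G -> int * int, forall n g i j,
  c (zpow k n * g * (zpow u i * zpow v j)) = ((c g).1 + i, (c g).2 + j)%R.
Proof.
have [c cP] := choice coord_ex; exists c => n g i j.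
have [m gE] := cP g; have [m'] := cP (zpow k n * g * (zpow u i * zpow v j)).
set g' := (X in X = _ -> _); have -> : rep g' = rep g by rewrite /rep cls_eq.
rewrite /g' {1}gE; set a := c g; set b := c _; set r := rep g => E.
have {}E : zpow k (n + m)%R * r * (zpow u (a.1 + i)%R * zpow v (a.2 + j)%R) =
    zpow k m' * r * (zpow u b.1 * zpow v b.2).
  by rewrite -E -(gen2M cuv) zpowD !mulgA.
have /k_conj : zpow k (n + m - m')%R ^ r =
    zpow u (b.1 - (a.1 + i))%R * zpow v (b.2 - (a.2 + j))%R.
  rewrite -(gen2M cuv) -(gen2V cuv).
  apply: (mulIg (zpow u (a.1 + i)%R * zpow v (a.2 + j)%R)); rewrite mulgVK.
  apply: (mulgI (zpow k m' * r)); rewrite -E conjgE mulgA; congr (_ * _).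
  by rewrite -mulgA mulVKg mulgA -zpowD; congr (zpow _ _ * _); lia.
by case: b {E} => b1 b2 /= [/eqP + /eqP]; rewrite !subr_eq0 => /eqP-> /eqP->.
Qed.

(** If [x] had a finite orbit, powers of [u] and of [v] would fix it, and its
    restriction to [<u, v>] would be a doubly periodic tiling of [Z^2]. *)
Lemma free_extension_not_rigid : k != 1 -> ~ periodically_rigid G.
Proof.
move=> k1 rigid; pose X : set (G -> tile) :=
  [set x | forall g, kari_rule (x g) (x (g * u)) (x (g * v))].
have [c cP] := coordinates; have [w wP] := kari_tiling.
pose y g := w (c g).1 (c g).2.
have cu g : c (g * u) = ((c g).1 + 1, (c g).2)%R.
  by have := cP 0%R g 1%R 0%R; rewrite mul1g zpow1 mulg1 addr0.
have cv g : c (g * v) = ((c g).1, (c g).2 + 1)%R.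
  by have := cP 0%R g 0%R 1%R; rewrite mul1g zpow1 mul1g addr0.
have Xy : X y by move=> g; rewrite /y cu cv.
have [] : strongly_aperiodic X; last first.
  move=> _ /(_ _ Xy) st; have : stab y k.
    apply/funext => h; rewrite /shift /y; congr w.
      by have := cP (-1)%R h 0%R 0%R; rewrite !mulg1 !addr0 zpowN zpow1 => ->.
    by have := cP (-1)%R h 0%R 0%R; rewrite !mulg1 !addr0 zpowN zpow1 => ->.
  by rewrite st => /= kE; rewrite kE eqxx in k1.
apply: rigid; first by rewrite !card_prod card_bool !card_ord.
  exact: neighbour_rule_SFT.
split; first by exists y.
move=> x Xx fin_x.
have [m m0 mP] := finite_orbit_period u fin_x.
have [p p0 pP] := finite_orbit_period v fin_x.
apply: (@kari_no_double_period (fun i j => x (zpow u i * zpow v j))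
  _ m p m0 p0) => i j.
- have -> : zpow u (i + 1)%R * zpow v j = zpow u i * zpow v j * u.
    by have := gen2M cuv i j 1 0; rewrite mulg1 addr0 zpow1 => ->.
  have -> : zpow u i * zpow v (j + 1)%R = zpow u i * zpow v j * v.
    by rewrite zpowS mulgA.
  exact: Xx.
- by rewrite addrC zpowD -mulgA mP.
- rewrite addrC zpowD mulgA.
  have -> : zpow u i * zpow v p = zpow v p * zpow u i.
    by apply/commute_sym/commute_zpow/commute_sym/commute_zpow.
  by rewrite -mulgA pP.
Qed.

End FreeExtension.

(** * Finite index and homomorphisms to the integers *)

Section FiniteIndex.
Variable G : groupType.
Implicit Types (H K M : set G) (g h k : G) (s : seq G).

(** Finitely many left cosets of [H] cover [K].  For [H] inside [K] this is
    finite index; it can be stated for arbitrary sets, and it composes. *)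
Definition covers H K : Prop :=
  exists s, forall k, K k -> exists2 r, r \in s & H (r^-1 * k).

Lemma finite_index_covers H : is_subgroup H -> finite_index H -> covers H setT.
Proof.
move=> gH /finite_seqP[cs csE]; pose rep (C : set G) := xget 1 [set g | lcoset g H = C].
exists [seq rep C | C <- cs] => k _; exists (rep (lcoset k H)).
  apply: map_f; have : [set lcoset g H | g in [set: G]] (lcoset k H) by exists k.
  by rewrite csE.
have : lcoset (rep (lcoset k H)) H = lcoset k H.
  exact: (@xgetI _ 1 [set g | lcoset g H = lcoset k H] k).
have : lcoset k H k by exists 1; [exact: subgroup1|rewrite mulg1].
by move: (rep _) => r kHk E; move: kHk; rewrite -E => -[h Hh <-]; rewrite mulKg.
Qed.

Lemma covers_finite_index H : is_subgroup H -> covers H setT -> finite_index H.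
Proof.
move=> gH [s sP]; apply: (@sub_finite_set _ _ [set lcoset g H | g in [set` s]]).
  move=> _ [k _ <-]; have [r rs Hrk] := sP k I; exists r => //.
  apply/seteqP; split=> _ [h Hh <-].
    exists ((r^-1 * k)^-1 * h); last by rewrite invgM invgK -mulgA mulVKg.
    by apply: subgroupM => //; exact: subgroupV.
  exists (r^-1 * k * h); first exact: subgroupM.
  by rewrite !mulgA mulgV mul1g.
exact: finite_image.
Qed.

Lemma covers_refl K : is_subgroup K -> covers K K.
Proof.
by move=> gK; exists [:: 1] => k Kk; exists 1; rewrite ?inE // invg1 mul1g.
Qed.

Lemma covers_trans H M K : covers H M -> covers M K -> covers H K.
Proof.
move=> [s sP] [s' sP']; exists [seq r' * r | r' <- s', r <- s] => k /sP'[r' r's'].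
move=> /sP[r rs Hk]; exists (r' * r); first exact: allpairs_f.
by rewrite invgM -mulgA.
Qed.

(** Among the first powers of [k], one more than there are cosets, two lie in
    the same coset of [H]; the exponents obtained in this way are bounded by
    the number of cosets, and its factorial is a multiple of all of them. *)
Lemma covers_power H K : is_subgroup H -> is_subgroup K -> covers H K ->
  exists2 N : nat, (0 < N)%N & forall k, K k -> H (k ^+ N).
Proof.
move=> gH gK [s sP]; exists ((size s)`!)%N; first exact: fact_gt0.
move=> k Kk; have Kkn n : K (k ^+ n) by exact: (subgroup_zpow gK n Kk).
have /choice[r rP] : forall n : nat, exists r, r \in s /\ H (r^-1 * k ^+ n).
  by move=> n; have [r] := sP _ (Kkn n); exists r.
have [a [b [ab bs rab]]] := pigeonhole_seq (fun n => (rP n).1).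
have Hba : H (k ^+ (b - a)).
  have [_ Ha] := rP a; have [_] := rP b; rewrite -rab => Hb.
  have := subgroupM gH (subgroupV gH Ha) Hb.
  rewrite invgM invgK -mulgA mulVKg.
  by rewrite -{1}(subnKC (ltnW ab)) expgnDr mulKg.
have /dvdnP[q ->] : (b - a %| (size s)`!)%N.
  by apply: dvdn_fact; rewrite subn_gt0 ab /= (leq_trans (leq_subr _ _)).
by rewrite mulnC expgnA; exact: (subgroup_zpow gH q Hba).
Qed.

Definition additive_on K (phi : G -> int) : Prop :=
  forall g h, K g -> K h -> phi (g * h) = (phi g + phi h)%R.

Section Additive.
Variables (K : set G) (phi : G -> int).
Hypotheses (gK : is_subgroup K) (phiD : additive_on K phi).

Lemma additive1 : phi 1 = 0%R.
Proof.
have K1 := subgroup1 gK.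
by apply: (addrI (phi 1)); rewrite -phiD // mulg1 addr0.
Qed.

Lemma additiveV g : K g -> phi g^-1 = (- phi g)%R.
Proof.
move=> Kg; apply: (addrI (phi g)).
by rewrite -phiD ?subrr ?mulgV ?additive1 //; exact: subgroupV.
Qed.

Lemma additiveX g (n : int) : K g -> phi (zpow g n) = (n * phi g)%R.
Proof.
move=> Kg; have nat_mul (m : nat) : phi (g ^+ m) = (m%:Z * phi g)%R.
  elim: m => [|m IH]; first by rewrite expg0 additive1 mul0r.
  rewrite expgS phiD // ?IH ?PoszS; last exact: (subgroup_zpow gK m Kg).
  by rewrite mulrDl mul1r addrC.
case: n => n; first exact: nat_mul.
by rewrite NegzE mulNr -nat_mul; apply: additiveV; exact: (subgroup_zpow gK n.+1 Kg).
Qed.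

Lemma additiveJ g h : K g -> K h -> phi (g ^ h) = phi g.
Proof.
move=> Kg Kh; rewrite conjgE !phiD ?additiveV; first by lia.
all: by repeat first [assumption | apply: subgroupM | apply: subgroupV].
Qed.
End Additive.

(** If [a] is good for all homomorphisms but [Phi i] and [Phi i g] is not 0,
    then [a^N g] is good for all of them once [N] is large. *)
Lemma common_nonzero K (I : eqType) (Phi : I -> G -> int) (s : seq I) :
  is_subgroup K -> (forall i, i \in s -> additive_on K (Phi i)) ->
  (forall i, i \in s -> exists2 g, K g & Phi i g <> 0%R) ->
  exists2 k, K k & forall i, i \in s -> Phi i k <> 0%R.
Proof.
move=> gK; elim: s => [|i s IH] addP exP; first by exists 1; [exact: subgroup1|].
have [j js|j js|a Ka aP] := IH; [exact/addP/mem_behead|exact/exP/mem_behead|].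
have i_in : i \in i :: s by exact: mem_head.
have [g Kg gP] := exP i i_in.
have [ia|ia] := pselect (Phi i a = 0%R); last first.
  by exists a => // j; rewrite inE => /predU1P[->|/aP].
pose N := (\sum_(j <- s) absz (Phi j g)).+1.
have KaN : K (zpow a N) by exact: subgroup_zpow.
exists (zpow a N * g); first exact: subgroupM.
move=> j; rewrite inE => /predU1P[->|js].
  by rewrite (addP i) // (additiveX gK (addP i i_in)) // ia mulr0 add0r.
have j_in : j \in i :: s by rewrite inE js orbT.
rewrite (addP j) // (additiveX gK (addP j j_in)) //.
have : (absz (Phi j g) < N)%N by rewrite ltnS (big_rem j) //= leq_addr.
by have := aP j js; nia.
Qed.

(** Virtually, [K] maps onto [Z] with a kernel containing [Z^2].  This is how
    the groups of Hirsch length at least 3 arise along a polycyclic series. *)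
Definition fibred K : Prop :=
  exists (K' : set G) (phi : G -> int) b u v,
  [/\ is_subgroup K', K' `<=` K, covers K' K, additive_on K' phi &
   [/\ K' b, phi b <> 0%R, commute u v, free_pair u v &
    [/\ K' u, K' v, phi u = 0%R & phi v = 0%R]]].

(** The element [k] required by [free_extension_not_rigid] is one at which the
    conjugates of [phi] by the coset representatives of [K] do not vanish: a
    conjugate of [k^n] by any [g] is also conjugate inside [K] to [(k^r)^n]
    for one representative [r], where [phi] takes the value [n (phi (k^r))].
    This is not 0 unless [n = 0], whereas [phi] vanishes on [<u, v>]. *)
Lemma fibred_not_rigid : fibred setT -> ~ periodically_rigid G.
Proof.
move=> [K [phi [b [u [v [gK _ cK phiD [Kb pb cuv fuv [Ku Kv pu pv]]]]]]]].
have [|N N0 powN] := covers_power gK _ cK.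
  by apply: is_subgroupP.
have [s sP] := cK.
(* the common domain of the conjugates of phi *)
pose C := [set x | forall r, r \in s -> K (x ^ r)].
have gC : is_subgroup C.
  apply: is_subgroupP => [r _|g h Cg Ch r rs]; first by rewrite conj1g; exact: subgroup1.
  rewrite conjMg conjVg; apply: subgroupM => //; first exact: Cg.
  by apply: subgroupV => //; exact: Ch.
have [|r rs|k Ck kP] := @common_nonzero C G (fun r x => phi (x ^ r)) s gC.
- by move=> r rs g h Cg Ch; rewrite conjMg phiD //; [exact: Cg|exact: Ch].
- exists (zpow (b ^ r^-1) N).
    by move=> r' _; rewrite zpowJ; exact: powN.
  rewrite zpowJ conjgKV (additiveX gK phiD) //; nia.
have k1 : k != 1.
  have [r rs _] := sP 1 I; apply/eqP => kE; apply: (kP r rs).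
  by rewrite kE conj1g (additive1 gK phiD).
apply: (free_extension_not_rigid cuv _ k1) => g n i j E.
have [r rs Kh] := sP g I; apply: fuv; rewrite -E.
suff -> : n = 0%R by rewrite conj1g.
have := congr1 phi E; rewrite phiD; try exact: subgroup_zpow.
rewrite !(additiveX gK phiD) // pu pv !mulr0 addr0.
have -> : g = r * (r^-1 * g) by rewrite mulgA mulgV mul1g.
rewrite conjgM (additiveJ gK phiD) //; last first.
  by rewrite zpowJ; apply: subgroup_zpow => //; exact: Ck.
rewrite zpowJ (additiveX gK phiD); last exact: Ck.
by have := kP r rs; nia.
Qed.

End FiniteIndex.

(** * Polycyclic groups of small rank *)

Section PolycyclicStructure.
Variable G : groupType.
Implicit Types (H K M : set G) (g h t u v z : G).

Definition cyc z : set G := [set g | exists n, g = zpow z n].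

Definition infinite_order z : Prop := forall n, zpow z n = 1 -> n = 0%R.

Lemma cyc_subgroup z : is_subgroup (cyc z).
Proof.
apply: is_subgroupP => [|_ _ [n ->] [m ->]]; first by exists 0%R.
by exists (n - m)%R; rewrite zpowD zpowN.
Qed.

Lemma infinite_order_inj z n m : infinite_order z -> zpow z n = zpow z m -> n = m.
Proof.
move=> oz E; apply/eqP; rewrite -subr_eq0; apply/eqP/oz.
by rewrite zpowD zpowN E mulgV.
Qed.

Lemma covers_cyc_pow z (N : nat) : (0 < N)%N -> covers (cyc (zpow z N)) (cyc z).
Proof.
move=> N0; exists [seq zpow z (Posz i) | i <- iota 0 N] => _ [n ->].
have N0' : Posz N != 0%R by lia.
exists (zpow z (n %% N)%Z).
  have := modz_ge0 n N0'; have lt : ((n %% N)%Z < N)%R by apply: ltz_pmod; lia.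
  case E : (n %% N)%Z lt => [i|//] lt _.
  by apply: map_f; rewrite mem_iota.
exists (n %/ N)%Z; rewrite -zpowN -zpowD -zpowM; congr (zpow z _).
by have := divz_eq n N; lia.
Qed.

Definition small_or_fibred K : Prop :=
  [\/ covers [set 1] K,
      exists z, [/\ K z, infinite_order z & covers (cyc z) K],
      exists u v, [/\ K u, K v, commute u v, free_pair u v & covers (gen2 u v) K] |
      fibred K].

Lemma small_or_fibred_finite_index M K :
  M `<=` K -> covers M K -> small_or_fibred M -> small_or_fibred K.
Proof.
move=> MK cM; case.
- by move=> c1; apply: Or41; exact: covers_trans cM.
- move=> [z [Mz oz cz]]; apply: Or42; exists z.
  by split=> //; [exact: MK|exact: covers_trans cM].
- move=> [u [v [Mu Mv cuv fuv cH]]]; apply: Or43; exists u, v.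
  by split=> //; [exact: MK|exact: MK|exact: covers_trans cM].
- move=> [K' [phi [b [u [v [gK K'M cK phiD P]]]]]]; apply: Or44.
  exists K', phi, b, u, v; split=> //; first exact: subset_trans MK.
  exact: covers_trans cM.
Qed.

(** One step of the series: [M] is normal in [K] and the powers of [t]
    represent all cosets of [M]. *)
Section InfiniteCyclicQuotient.
Variables (M K : set G) (t : G).
Hypotheses (gM : is_subgroup M) (gK : is_subgroup K).
Hypothesis nMK : is_normal_in M K.
Hypothesis Kt : K t.
Hypothesis Kgen : forall g, K g -> exists k : int, M (zpow t (- k)%R * g).

Let Ktn n : K (zpow t n). Proof. exact: subgroup_zpow. Qed.

Let MJ g h : K g -> M h -> M (h ^ g). Proof. exact: nMK.2. Qed.

Let decompose g : K g -> exists k, exists2 m, M m & g = m * zpow t k.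
Proof.
move=> Kg; have [k Mk] := Kgen Kg; exists k.
exists ((zpow t (- k)%R * g) ^ zpow t (- k)%R); first exact: MJ.
by rewrite conjgE -!mulgA -zpowD addNr mulg1 zpowN invgK mulVKg.
Qed.

Lemma finite_index_of_torsion_quotient n :
  (0 < n)%N -> M (zpow t (Posz n)) -> covers M K.
Proof.
move=> n0 Mtn; exists [seq zpow t (Posz i) | i <- iota 0 n] => g Kg.
have [k Mk] := Kgen Kg; have n0' : Posz n != 0%R by lia.
exists (zpow t (k %% n)%Z).
  have := modz_ge0 k n0'.
  have lt : ((k %% n)%Z < n)%R by apply: ltz_pmod; lia.
  case E : (k %% n)%Z lt => [i|//] lt _.
  by apply: map_f; rewrite mem_iota.
rewrite -zpowN.
have -> : (- (k %% n)%Z = (Posz n * (k %/ n)%Z) - k)%R.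
  by have := divz_eq k n; lia.
by rewrite zpowD -mulgA; apply: subgroupM => //; rewrite zpowM; exact: subgroup_zpow.
Qed.

Hypothesis Mt : forall n : int, M (zpow t n) -> n = 0%R.

(** Distinct powers of [t] represent distinct cosets of [M], and [phi g] is the
    exponent of the one in the coset of [g]. *)
Lemma quotient_height : exists phi : G -> int,
  [/\ additive_on K phi, phi t = 1%R & forall m, M m -> phi m = 0%R].
Proof.
have /choice[phi phiP] : forall g, exists k : int, K g -> M (zpow t (- k)%R * g).
  move=> g; have [Kg|nKg] := pselect (K g); last by exists 0%R.
  by have [k Mk] := Kgen Kg; exists k.
have phi_unique g k : K g -> M (zpow t (- k)%R * g) -> phi g = k.
  move=> Kg Mk; apply/eqP; rewrite -subr_eq0; apply/eqP/Mt.
  have := subgroupM gM Mk (subgroupV gM (phiP g Kg)).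
  rewrite invgM mulgA mulgK -zpowN opprK -zpowD.
  by rewrite addrC.
exists phi; split=> [g h Kg Kh||m Mm].
- apply: phi_unique; first exact: subgroupM.
  rewrite opprD addrC zpowD.
  have -> : zpow t (- phi h)%R * zpow t (- phi g)%R * (g * h) =
    (zpow t (- phi g)%R * g) ^ zpow t (phi h) * (zpow t (- phi h)%R * h).
    rewrite conjgE -zpowN -!mulgA; do 3!congr (_ * _).
    by rewrite mulgA -zpowD subrr mul1g.
  by apply: subgroupM => //; [apply: MJ => //|]; exact: phiP.
- by apply: phi_unique => //; rewrite zpowN zpow1 mulVg; exact: subgroup1.
- by apply: phi_unique; [exact: nMK.1|rewrite mul1g].
Qed.

Lemma virtually_cyclic_extension :
  covers [set 1] M -> covers (cyc t) K.
Proof.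
move=> [s sP]; exists s => g /decompose[k [m Mm ->]].
have [r rs r1] := sP m Mm; exists r => //.
by rewrite mulgA r1 mul1g; exists k.
Qed.

(** Conjugation by [t] carries a power of [z] to the same power of [z] or of
    its inverse, so that [t^2] centralizes it.  Indeed all powers of [t]
    conjugate [z^N], for a suitable [N], to a power [z^(d n)], and
    [N d(n + 1) = d(1) d(n)]: the two-sided sequence [d] is geometric with
    ratio [d(1) / N].  Being a sequence of non-zero integers, it attains its
    least absolute value, which forces the ratio to be 1 or -1. *)
Lemma central_power z : M z -> infinite_order z -> covers (cyc z) M ->
  exists2 N : nat, (0 < N)%N & commute (zpow z N) (t * t).
Proof.
move=> Mz oz cz; have [N N0 powN] := covers_power (cyc_subgroup z) gM cz.
exists N => //.
have /choice[d dP] : forall n : int, exists d : int,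
    zpow z N ^ zpow t n = zpow z d.
  by move=> n; rewrite zpowJ; apply: powN; exact: MJ.
have d_rec n : (d (n + 1) * N = d 1 * d n)%R.
  apply: (infinite_order_inj oz).
  rewrite zpowM -dP zpowS conjgM (zpowM z (d 1%R)) -dP zpow1 -[RHS]zpowJ.
  by rewrite -[in RHS]zpowM (mulrC (Posz N)) [in RHS]zpowM -dP [RHS]zpowJ.
have d_neq0 n : d n <> 0%R.
  move=> d0; have := dP n; rewrite d0 zpow0 => /eqP; rewrite conjg_eq1 => /eqP/oz.
  by lia.
have ex_abs : exists k, `[< exists n, absz (d n) = k >].
  by exists (absz (d 0%R)); apply/asboolP; exists 0%R.
case: (ex_minnP ex_abs) => k /asboolP[n dn] kmin.
have dmin n' : (absz (d n) <= absz (d n'))%N.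
  by rewrite dn; apply: kmin; apply/asboolP; exists n'.
have d1 : absz (d 1%R) = N.
  have := d_rec n; have := d_rec (n - 1)%R; rewrite subrK.
  have := dmin (n + 1)%R; have := dmin (n - 1)%R; have := d_neq0 n.
  move: (d n) (d 1%R) (d (n + 1)%R) (d (n - 1)%R) => a b c e a0 ae ac E1 E2.
  have {}E1 : (absz a * N = absz b * absz e)%N by rewrite -abszM -E1 abszM.
  have {}E2 : (absz c * N = absz b * absz a)%N by rewrite -abszM -E2 abszM.
  have {}a0 : (0 < absz a)%N by lia.
  by nia.
have wt : zpow z N ^ t = zpow (zpow z N) (sgz (d 1%R)).
  have := dP 1%R; rewrite zpow1 => ->; rewrite -zpowM; congr (zpow z _).
  by rewrite -d1; lia.
apply/commgP; rewrite -conjg_fix conjgM wt zpowJ wt -zpowM.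
have -> : (sgz (d 1) * sgz (d 1) = 1)%R by have := d_neq0 1%R; lia.
by rewrite zpow1.
Qed.

Lemma rank_two_extension z :
    M z -> infinite_order z -> covers (cyc z) M ->
  exists u v, [/\ K u, K v, commute u v, free_pair u v & covers (gen2 u v) K].
Proof.
move=> Mz oz cz; have [N N0 cN] := central_power Mz oz cz.
have tt q : zpow (t * t) q = zpow t (2 * q)%R by rewrite zpowM.
exists (zpow z N), (t * t); split=> //.
- by apply: nMK.1; exact: subgroup_zpow.
- exact: subgroupM.
- move=> i j; rewrite tt -zpowM => E.
  have j0 : j = 0%R.
    have : M (zpow t (2 * j)%R).
      by rewrite -(mulg1_eq E); apply: subgroupV => //; exact: subgroup_zpow.
    by move/Mt; lia.
  by move: E; rewrite j0 mulr0 mulg1 => /oz; nia.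
have [s sP] := covers_trans (covers_cyc_pow z N0) cz.
exists ([seq zpow t 0 * r | r <- s] ++ [seq zpow t 1 * r | r <- s]) => g.
move=> /decompose[k [m Mm ->]].
have [e [q [kE eE]]] : exists e q : int, k = (e + 2 * q)%R /\ (e = 0 \/ e = 1)%R.
  by exists (k %% 2)%Z, (k %/ 2)%Z; split; [rewrite {1}(divz_eq k 2)|]; lia.
have Mm' : M (m ^ zpow t e) by exact: MJ.
have [r rs [i wE]] := sP _ Mm'.
exists (zpow t e * r).
  by rewrite mem_cat; case: eE => ->; rewrite map_f ?orbT.
exists i, q; rewrite tt -wE kE zpowD conjgE invgM !mulgA.
by [].
Qed.

(** The homomorphism is the one of kernel [M], defined on the whole of [K]. *)
Lemma fibred_extension u v :
  M u -> M v -> commute u v -> free_pair u v -> fibred K.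
Proof.
move=> Mu Mv cuv fuv; have [phi [phiD phit phiM]] := quotient_height.
exists K, phi, t, u, v; split=> //; first exact: covers_refl.
split=> //; first by rewrite phit.
by split; [exact: nMK.1|exact: nMK.1|exact: phiM|exact: phiM].
Qed.

End InfiniteCyclicQuotient.

Lemma small_or_fibred_extension M K : is_subgroup M -> is_subgroup K ->
  is_normal_in M K -> cyclic_quotient K M ->
  small_or_fibred M -> small_or_fibred K.
Proof.
move=> gM gK nMK [t Kt tP] clM.
have Kgen g : K g -> exists k : int, M (zpow t (- k)%R * g).
  move=> Kg; have [k gkE] := tP g Kg; exists k.
  have : lcoset g M g by exists 1; [exact: subgroup1|rewrite mulg1].
  by rewrite gkE => -[m Mm <-]; rewrite zpowN mulKg.
have [[n n0 Mn]|tors] := pselect (exists2 n : nat, (0 < n)%N & M (zpow t (Posz n))).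
  apply: small_or_fibred_finite_index clM; first exact: nMK.1.
  exact: finite_index_of_torsion_quotient Mn.
have Mt n : M (zpow t n) -> n = 0%R.
  case: n => [[|n]|n] // Mn; case: tors; exists n.+1 => //.
  by rewrite -[zpow _ _]invgK; apply: subgroupV.
case: clM.
- move=> cM; apply: Or42; exists t; split=> //.
    by move=> n t1; apply: Mt; rewrite t1; exact: subgroup1.
  exact: (virtually_cyclic_extension gK nMK Kt Kgen).
- move=> [z [Mz oz cz]]; apply: Or43.
  exact: (rank_two_extension gM gK nMK Kt Kgen Mt Mz).
- move=> [u [v [Mu Mv cuv fuv _]]]; apply: Or44.
  exact: (fibred_extension gM gK nMK Kt Kgen Mt Mu Mv).
- move=> [K' [phi [b [u [v [_ K'M _ _ [_ _ cuv fuv [K'u K'v _ _]]]]]]]]; apply: Or44.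
  apply: (fibred_extension gM gK nMK Kt Kgen Mt _ _ cuv fuv); exact: K'M.
Qed.

Lemma polycyclic_small_or_fibred : polycyclic G -> small_or_fibred [set: G].
Proof.
move=> [n [S [gS S0 Sn step]]]; rewrite -Sn.
have : (n <= n)%N by [].
elim: {-2}n => [_|i IH lt_i].
  by rewrite S0; apply: Or41; apply: covers_refl; rewrite -S0; exact: gS.
have [nS cS] := step i lt_i.
by apply: (small_or_fibred_extension _ _ nS cS); [exact/gS/ltnW|exact: gS|exact/IH/ltnW].
Qed.

End PolycyclicStructure.

(** * Configurations with a finite orbit *)

(** If the windows of [z] at [a] and at [b = a + p] agree, the word of [z] from
    [a] to [b] is repeated indefinitely.  The result [z'] agrees with [z] on
    [p + L] letters from [a] on, and any window of length [L] is a translate of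
    one starting within the first period. *)
Lemma periodic_windows (B : finType) (z : int -> B) (L : nat) :
  exists p : nat, exists z' : int -> B,
  [/\ (0 < p)%N, forall n, z' (n + Posz p)%R = z' n &
      forall n, exists c, forall m : nat, (m < L)%N ->
        z' (n + Posz m)%R = z (c + Posz m)%R].
Proof.
pose win n := [ffun m : 'I_L => z (Posz n + Posz m)%R].
have win_in n : win n \in enum {: {ffun 'I_L -> B}} by rewrite mem_enum.
have [a [b [ab _ wab]]] := pigeonhole_seq win_in.
pose p := (b - a)%N; have p0 : (0 < p)%N by rewrite subn_gt0.
have bE : b = (a + p)%N by rewrite /p subnKC // ltnW.
pose z' (n : int) := z (Posz a + (n %% p)%Z)%R.
have z'p n : z' (n + Posz p)%R = z' n by rewrite /z' modzDr.
have z'E (m : nat) : (m < p + L)%N -> z' (Posz m) = z (Posz a + Posz m)%R.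
  elim/ltn_ind: m => m IH lt_m.
  have [mp|pm] := ltnP m p; first by rewrite /z' modz_nat modn_small.
  have lt_mp : (m - p < L)%N by lia.
  have := congr1 (fun f : {ffun 'I_L -> B} => f (Ordinal lt_mp)) wab.
  rewrite !ffunE /= => zab.
  have -> : Posz m = (Posz (m - p) + Posz p)%R by lia.
  rewrite z'p IH; [|lia|lia].
  by rewrite zab; congr (z _); lia.
exists p, z'; split=> // n; exists (Posz a + (n %% p)%Z)%R => m mL.
have n0 := modz_ge0 n (_ : Posz p != 0%R).
have [r rE] : exists r : nat, (n %% p)%Z = Posz r.
  by exists (absz (n %% p)%Z); rewrite gez0_abs // n0 //; lia.
have rp : (r < p)%N by have := ltz_pmod n (_ : (0 < Posz p)%R); rewrite rE; lia.
have -> : z' (n + Posz m)%R = z' (Posz (r + m)).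
  by rewrite /z' PoszD -rE modzDml.
rewrite z'E ?rE ?PoszD ?addrA //; lia.
Qed.

(** Every [g] is [t^n v^j r] with [r] in a finite set of representatives of the
    right cosets of [<t, v>].  The height [n] and [r] determine [x g] as [x] is
    fixed by [v], so [x] is a word in [n] whose letters are the functions of
    [r]. *)
Section FiniteOrbitPoint.
Variables (G : groupType) (A : finType) (X : set (G -> A)) (t v : G) (x : G -> A).
Implicit Types (g h : G) (i j n : int).
Hypothesis sftX : is_SFT X.
Hypothesis ctv : commute t v.
Hypothesis tv_height : forall i j, zpow t i * zpow v j = 1 -> i = 0%R.
Hypothesis cH : covers (gen2 t v) setT.
Hypothesis Xx : X x.
Hypothesis vx : shift v x = x.

Let cls g : set G := [set g' | exists i j, g' = zpow t i * zpow v j * g].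

Let rep g := xget 1 (cls g).

Let rep_eq i j g : rep (zpow t i * zpow v j * g) = rep g.
Proof.
congr (xget 1 _); apply/seteqP; split=> _ [a [b ->]].
  by exists (a + i)%R, (b + j)%R; rewrite mulgA (gen2M ctv).
exists (a - i)%R, (b - j)%R; rewrite mulgA (gen2M ctv).
by rewrite !subrK.
Qed.

Let height_ex g : exists n, exists j, g = zpow t n * zpow v j * rep g.
Proof.
have : cls g (rep g).
  by apply: (@xgetI _ _ _ g); exists 0%R, 0%R; rewrite mulg1 mul1g.
case=> i [j E]; exists (- i)%R, (- j)%R.
by rewrite E mulgA (gen2M ctv) !addNr mulg1 mul1g.
Qed.

Let height_rep : exists (height : G -> int) (T : seq G),
  [/\ forall g, rep g \in T,
      forall g, exists j, g = zpow t (height g) * zpow v j * rep g &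
      forall i j g, height (zpow t i * zpow v j * g) = (i + height g)%R].
Proof.
have [height hP] := choice height_ex.
have [s sP] := cH; exists height, [seq rep r^-1 | r <- s]; split=> //.
  move=> g; have [r rs [i [j E]]] := sP g^-1 I.
  apply/mapP; exists r => //; have -> : g = zpow t (- i)%R * zpow v (- j)%R * r^-1.
    by rewrite -(gen2V ctv) -E invgM !invgK mulgK.
  exact: rep_eq.
move=> i j g; have [b gE] := hP g.
have [a] := hP (zpow t i * zpow v j * g); rewrite rep_eq [in X in X = _ -> _]gE.
set h' := height (_ * g); rewrite mulgA => /mulIg.
rewrite (gen2M ctv) => E.
have : zpow t (i + height g - h')%R * zpow v (j + b - a)%R = 1.
  by rewrite -(gen2M ctv) E -(gen2V ctv) mulgV.
by move/tv_height; lia.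
Qed.

Let x_invariant i j g : x (zpow t i * zpow v j * g) = x (zpow t i * g).
Proof.
have := congr1 (fun y : G -> A => y (zpow t i * zpow v j * g)) (shift_zpow j vx).
rewrite /shift => <-; congr x.
have -> : zpow t i * zpow v j = zpow v j * zpow t i.
  by apply/commute_zpow/commute_sym/commute_zpow/commute_sym.
by rewrite -mulgA mulKg.
Qed.

Lemma finite_orbit_of_periods (y : G -> A) (p : nat) : (0 < p)%N ->
  shift v y = y -> shift (zpow t p) y = y -> finite_set (orbit y).
Proof.
move=> p0 vy ty; have [s sP] := cH.
apply: (@sub_finite_set _ _
  [set shift (r * zpow t (Posz i)) y | r in [set` s] & i in `I_p]); last first.
  by apply: finite_image2 => //; exact: finite_seq.
move=> _ [g _ <-]; have [r rs [i [j E]]] := sP g I.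
have p0' : Posz p != 0%R by lia.
exists r => //; exists (absz (i %% p)%Z).
  have lt_p : ((i %% p)%Z < p)%R by apply: ltz_pmod; lia.
  by have := modz_ge0 i p0'; rewrite /mkset; lia.
rewrite (gez0_abs (modz_ge0 i p0')).
have -> : g = r * zpow t (i %% p)%Z * (zpow (zpow t p) (i %/ p)%Z * zpow v j).
  rewrite -zpowM mulgA -[r * _ * _]mulgA -zpowD.
  have -> : ((i %% p)%Z + Posz p * (i %/ p)%Z)%R = i.
    by have := divz_eq i p; lia.
  by rewrite -mulgA -E mulVKg.
by rewrite [RHS]shiftM [in RHS]shiftM (shift_zpow _ vy) (shift_zpow _ ty).
Qed.

(** Multiplying [g] on the right by an element of a forbidden pattern changes
    the height by a bounded amount, which depends only on the representative of
    [g]: this bounds the length of the windows of the word that an occurrence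
    of the pattern can see.  If all these windows occur in the word of [x],
    each pattern seen is also one of [x]. *)
Lemma SFT_finite_orbit_point : exists2 y, X y & finite_set (orbit y).
Proof.
have [height [T [repT hrep hD]]] := height_rep.
have idxP g : (index (rep g) T < size T)%N by rewrite index_mem.
pose idx g : 'I_(size T) := Ordinal (idxP g).
have idx_eq i j g : idx (zpow t i * zpow v j * g) = idx g.
  by apply: val_inj; rewrite /= rep_eq.
have [P XE] := sftX.
pose S := flatten [seq enum_fset (domf p) | p <- enum_fset P].
pose b := \max_(e <- T) \max_(h <- S) absz (height (e * h)%g).
have bP g h : h \in S -> (absz (height (g * h)%g - height g)%R <= b)%N.
  move=> hS; have [j gE] := hrep g.
  rewrite {1}gE -mulgA hD addrC addKr.
  have in_T := @leq_bigmax_seq _ T xpredT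
    (fun e => \max_(h <- S) absz (height (e * h)%g)) (rep g) (repT g) isT.
  apply: leq_trans in_T.
  exact: (@leq_bigmax_seq _ S xpredT (fun h => absz (height (rep g * h)%g)) h).
(* the letter of x at height n; nth has a value for every e, as e < size T *)
pose z n := [ffun e : 'I_(size T) => x (zpow t n * nth 1 T e)].
have xE g : x g = z (height g) (idx g).
  have [j gE] := hrep g.
  by rewrite ffunE /= nth_index // [in LHS]gE x_invariant.
have [p [z' [p0 z'p z'E]]] := periodic_windows z (2 * b).+1.
pose y g := z' (height g) (idx g).
have y_inv i j g : y (zpow t i * zpow v j * g) = z' (i + height g)%R (idx g).
  by rewrite /y hD idx_eq.
exists y; last first.
  apply: (finite_orbit_of_periods p0); apply/funext => g; rewrite /shift.
    by have := y_inv 0%R (-1)%R g; rewrite mul1g zpowN zpow1 add0r.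
  have := y_inv (- Posz p)%R 0%R g; rewrite mulg1 zpowN => ->.
  by rewrite -z'p; congr (z' _ _); lia.
rewrite XE => q qP [g gq].
have [c cP] := z'E (height g - Posz b)%R.
have := Xx; rewrite XE => /(_ q qP); apply.
(* the translate of g whose height is the middle of the window of z at c *)
exists (zpow t (c + Posz b - height g)%R * g) => h.
have hS : val h \in S.
  apply/flattenP; exists (enum_fset (domf q)); last exact: valP.
  exact: (map_f (fun p : {fmap G -> A} => enum_fset (domf p))) qP.
rewrite gq /y; have := bP g _ hS; set d := (height (g * val h)%g - height g)%R => db.
have dbE : Posz (absz (Posz b + d)%R) = (Posz b + d)%R by lia.
have := cP (absz (Posz b + d)%R); rewrite dbE.
have -> : (height g - Posz b + (Posz b + d))%R = height (g * val h) by rewrite /d; lia.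
move=> ->; last by lia.
rewrite xE -mulgA; have -> : zpow t (c + Posz b - height g)%R * (g * val h) =
   zpow t (c + Posz b - height g)%R * zpow v 0 * (g * val h) by rewrite mulg1.
by rewrite hD idx_eq; congr (z _ _); rewrite /d; lia.
Qed.

End FiniteOrbitPoint.

(** * Coordinates on free abelian subgroups *)

Section FreeAbelianSubgroups.
Variable G : groupType.
Implicit Types (u v z g : G) (H : set G).

Lemma cyc_isomorphic z : infinite_order z -> isomorphic_to_Zd 1 (cyc z).
Proof.
move=> oz; exists (fun w : 'rV[int]_1 => zpow z (w 0 0)%R).
  by move=> w w'; rewrite mxE zpowD.
split=> [w _|w w' _ _ /(infinite_order_inj oz) E|_ [n ->]].
- by exists (w 0 0)%R.
- by apply/rowP => i; rewrite ord1.
- by exists (const_mx n); rewrite ?mxE.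
Qed.

Lemma gen2_isomorphic u v :
  commute u v -> free_pair u v -> isomorphic_to_Zd 2 (gen2 u v).
Proof.
move=> cuv fuv; exists (fun w : 'rV[int]_2 => zpow u (w 0 0)%R * zpow v (w 0 1)%R).
  by move=> w w'; rewrite !mxE -(gen2M cuv).
split=> [w _|w w' _ _ /(free_pair_inj cuv fuv)[E0 E1]|_ [i [j ->]]].
- by exists (w 0 0)%R, (w 0 1)%R.
- apply/rowP => i; have [->//|->//] : i = 0%R \/ i = 1%R.
  by case: i => [[|[|//]] lt_i]; [left|right]; exact: val_inj.
- by exists (\row_k if k == 0 then i else j)%R; rewrite ?mxE.
Qed.

Section Converse.
Variables (d : nat) (f : 'rV[int]_d -> G).
Hypothesis fD : {morph f : a b / (a + b)%R >-> a * b}.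

Lemma row_morph0 : f 0%R = 1.
Proof. by apply: (mulgI (f 0%R)); rewrite -fD addr0 mulg1. Qed.

Lemma row_morphZ n (w : 'rV[int]_d) : f (n *: w)%R = zpow (f w) n.
Proof.
elim/int_ind: n => [|n IH|n IH]; first by rewrite scale0r row_morph0.
  by rewrite PoszS scalerDl scale1r fD IH zpowS.
by apply: (mulIg (f w)); rewrite -fD -zpowS -{2}(scale1r w) -scalerDl
  PoszS opprD subrK IH.
Qed.
End Converse.

Lemma isomorphic_cyc H : isomorphic_to_Zd 1 H ->
  exists2 z, infinite_order z & H = cyc z.
Proof.
move=> [f fD [f_fun f_inj f_surj]].
have fE w : f w = zpow (f (const_mx 1%R)) (w 0 0)%R.
  rewrite -(row_morphZ fD); congr f; apply/rowP => i.
  by rewrite !mxE ord1 mulr1.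
exists (f (const_mx 1%R)).
  move=> n; rewrite -(row_morphZ fD) -(row_morph0 fD) => /f_inj.
  by rewrite !in_setE => /(_ I I) /rowP/(_ 0%R); rewrite !mxE mulr1.
apply/seteqP; split=> g; first by move=> /f_surj[w _ <-]; exists (w 0 0)%R.
by move=> [n ->]; rewrite -(row_morphZ fD); exact: f_fun.
Qed.

Lemma isomorphic_gen2 H : isomorphic_to_Zd 2 H ->
  exists u v, [/\ commute u v, free_pair u v & H = gen2 u v].
Proof.
move=> [f fD [f_fun f_inj f_surj]].
pose e k := f (delta_mx 0 k)%R.
have eE i j : zpow (e 0%R) i * zpow (e 1%R) j =
    f (i *: delta_mx 0 0 + j *: delta_mx 0 1)%R.
  by rewrite fD !(row_morphZ fD).
exists (e 0%R), (e 1%R); split.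
- by rewrite /commute -!fD addrC.
- move=> i j; rewrite eE -(row_morph0 fD) => /f_inj; rewrite !in_setE => /(_ I I) E.
  have /rowP := E; move=> E'; move: (E' 0%R) (E' 1%R).
  by rewrite !mxE /= !mulr1 !mulr0 addr0 add0r.
- apply/seteqP; split=> g; last by move=> [i [j ->]]; rewrite eE; exact: f_fun.
  move=> /f_surj[w _ <-]; exists (w 0 0)%R, (w 0 1)%R; rewrite eE; congr f.
  rewrite {1}[w]row_sum_delta big_ord_recl big_ord1.
  by congr (_ + w 0 _ *: delta_mx 0 _)%R; exact: val_inj.
Qed.

(** Euclidean division by [b] of the exponent of [v]. *)
Lemma covers_gen2_independent u v (a b : int) :
  commute u v -> b != 0%R ->
  covers (gen2 u (zpow u a * zpow v b)) (gen2 u v).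
Proof.
move=> cuv b0; exists [seq zpow v (Posz r) | r <- iota 0 (absz b)].
move=> _ [i [j ->]]; exists (zpow v (j %% b)%Z).
  have := modz_ge0 j b0; have lt : ((j %% b)%Z < `|b|)%R by exact: ltz_mod.
  case E : (j %% b)%Z lt => [r|//] lt _.
  by apply: map_f; rewrite mem_iota; lia.
exists (i - a * (j %/ b)%Z)%R, (j %/ b)%Z; rewrite (gen2X cuv).
have cv n m : commute (zpow v n) (zpow u m).
  by apply/commute_zpow/commute_sym/commute_zpow.
rewrite -zpowN mulgA (cv (- _)%R i) -mulgA -zpowD mulgA -zpowD.
by congr (zpow u _ * zpow v _); have := divz_eq j b; lia.
Qed.

Lemma gen2_swap u v : commute u v -> gen2 u v = gen2 v u.
Proof.
move=> cuv; have c i j : zpow u i * zpow v j = zpow v j * zpow u i.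
  by apply/commute_zpow/commute_sym/commute_zpow/commute_sym.
by apply/seteqP; split=> _ [i [j ->]]; exists j, i.
Qed.

Lemma free_pair_swap u v : commute u v -> free_pair u v -> free_pair v u.
Proof.
move=> cuv fuv i j; have -> : zpow v i * zpow u j = zpow u j * zpow v i.
  by apply/commute_zpow/commute_sym/commute_zpow.
by move=> /fuv[].
Qed.

End FreeAbelianSubgroups.

(** * Rigidity *)

Section Rigidity.
Variable G : groupType.

Lemma virtually_Z_rigid : virtually_Zd G 1 -> periodically_rigid G.
Proof.
move=> [H [gH fiH /isomorphic_cyc[z oz HE]]] A _ X sftX [[x Xx] inf].
have [||||y Xy] := @SFT_finite_orbit_point G A X z 1 x sftX _ _ _ Xx.
- exact: commute1.
- by move=> i j; rewrite zpow1g mulg1; exact: oz.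
- have [s sP] := finite_index_covers gH fiH; exists s => g _.
  have [r rs] := sP g I; rewrite HE => -[n E]; exists r => //.
  by exists n, 0%R; rewrite mulg1.
- exact: shift1.
by move/(inf y Xy).
Qed.

(** A power of an element [g <> 1] fixing [x] is [u^a v^b] with [a] and [b] not
    both 0.  If [b <> 0], the group generated by [u] and this power has finite
    index, and otherwise the one generated by [v] and this power. *)
Lemma virtually_Z2_rigid :
  torsion_free G -> virtually_Zd G 2 -> periodically_rigid G.
Proof.
move=> tf [H [gH fiH /isomorphic_gen2[u [v [cuv fuv HE]]]]] A _ X sftX [X0 inf].
split=> // x Xx; apply/seteqP; split=> g; last by move=> ->; exact: shift1.
move=> gx; apply: contrapT => g1.
have cH := finite_index_covers gH fiH.
have [|N N0 powN] := covers_power gH _ cH; first exact: is_subgroupP.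
have := powN g I; rewrite HE => -[a [b gN]].
have gN1 : g ^+ N <> 1 by move/(tf g N N0).
have gNx : shift (g ^+ N) x = x by exact: (shift_zpow (Posz N) gx).
have no_point u' v' a' b' : commute u' v' -> free_pair u' v' -> H = gen2 u' v' ->
    g ^+ N = zpow u' a' * zpow v' b' -> b' != 0%R -> False.
  move=> c' f' HE' gN' b'0.
  have [|i j||y Xy] := @SFT_finite_orbit_point G A X u' (g ^+ N) x sftX _ _ _ Xx gNx.
  - by rewrite gN'; apply: commuteM; apply: commute_zpow.
  - rewrite gN' (gen2X c') mulgA -zpowD => /f'[E /eqP].
    by rewrite mulf_eq0 (negPf b'0) /= => /eqP j0; move: E; rewrite j0 mulr0 addr0.
  - apply: covers_trans cH; rewrite HE' gN'; exact: covers_gen2_independent.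
  by move/(inf y Xy).
have [b0|b0] := eqVneq b 0%R; last exact: (no_point u v a b).
apply: (no_point v u 0%R a) => //.
- exact: (free_pair_swap cuv).
- by rewrite HE gen2_swap.
- by rewrite gN b0 mulg1 mul1g.
- by apply: contra_notN gN1 => /eqP a0; rewrite gN a0 b0 mulg1.
Qed.

End Rigidity.

Theorem theorem5 (G : groupType) :
  infinite_set [set: G]%classic -> finitely_generated G -> polycyclic G ->
  (periodically_rigid G <->
   virtually_Zd G 1 \/ (torsion_free G /\ virtually_Zd G 2)).
Proof.
move=> infG _ pG; split; last first.
  by move=> [|[tf]]; [exact: virtually_Z_rigid|exact: virtually_Z2_rigid].
move=> rigid; case: (polycyclic_small_or_fibred pG).
- move=> [s sP]; case: infG; apply: (@sub_finite_set _ _ [set` s]).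
    move=> g _; have [r rs /eqP] := sP g I.
    by rewrite mulg_eq1 eqg_inv => /eqP E; rewrite /= -E.
  exact: finite_seq.
- move=> [z [_ oz cz]]; left; exists (cyc z); split; first exact: cyc_subgroup.
    exact/covers_finite_index/cz/cyc_subgroup.
  exact: cyc_isomorphic.
- move=> [u [v [_ _ cuv fuv cH]]]; right; split; last first.
    exists (gen2 u v); split; first exact: gen2_subgroup.
      exact/covers_finite_index/cH/gen2_subgroup.
    exact: gen2_isomorphic.
  move=> k n n0 kn; apply/eqP/negPn/negP => k1.
  apply: (free_extension_not_rigid cuv _ k1) rigid => g m i j E.
  have : zpow (zpow u i * zpow v j) (Posz n) = 1.
    by rewrite -E zpowJ -zpowM mulrC zpowM /= -conjXg kn conj1g zpow1g.
  by rewrite (gen2X cuv) => /fuv[]; nia.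
- by move=> fib; case: (fibred_not_rigid fib rigid).
Qed.
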